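(* Let $n,d\in\mathbb{N}$ with $d\mid n$, and let $r,s\in\mathbb{Z}$. Then $$\sum_{\substack{k=1\\ (k,n)=1\\ k\equiv r\ (\mathrm{mod}\ d)}}^n c_n(k-s)=\begin{cases}\displaystyle \frac{\varphi(n)}{\varphi(d)}\sum_{\substack{e\mid n\\ (e,s)=1\\ (e,d)\mid r-s}}\frac{e\,\mu(n/e)}{\varphi(e)}\,\varphi((e,d)), & \text{if } (r,d)=1,\\[2ex] 0, & \text{if } (r,d)>1.\end{cases}$$
   Context: $\mathbb{N}$ is the set of positive integers. $(a,b)$ denotes the greatest common divisor (nonnegative, with $(0,n)=n$ for $n\in\mathbb{N}$). $\varphi$ is Euler's totient function and $\mu$ is the Möbius function. $c_n(k)$ is the Ramanujan sum, $c_n(k)=\sum_{1\le j\le n,\ (j,n)=1}e^{2\pi i jk/n}$ for $k\in\mathbb{Z}$. Sums over $e\mid n$ are over positive divisors. *)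

(* Defs.v *)
From mathcomp Require Import all_boot all_order all_algebra.
From mathcomp Require Import complex.
From mathcomp Require Import reals trigo.
Set Implicit Arguments.
Unset Strict Implicit.
Unset Printing Implicit Defensive.
Import Order.TTheory GRing.Theory Num.Theory.
Local Open Scope ring_scope.
Local Open Scope complex_scope.

(* e^{i t}, for real t *)
Definition expi (R : realType) (t : R) : R[i] := cos t +i* sin t.

Definition ramanujan_sum (R : realType) (n : nat) (k : int) : R[i] :=
  \sum_(1 <= j < n.+1 | coprime j n)
    expi (2 * pi * j%:R * k%:~R / n%:R : R).

(* Only meaningful for 0 < n. *)
Definition moebius (n : nat) : int :=
  if has (fun p => (p ^ 2 %| n)%N) (primes n) then 0
  else (-1) ^+ size (primes n).

(* Main.v *)
(* Moebius inversion on the condition (j, n) = 1 gives the evaluation of c_n(k)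
   as the sum of e mu(n/e) over the e dividing both n and k.  Exchanging sums,
   it remains to count the k <= n with (k, n) = 1, k = r mod d and k = s mod e.
   Unless (r, d) = (s, e) = 1 and (d, e) | r - s there are none; otherwise the
   two congruences amount to one modulo lcm(d, e), whose unit classes all lift
   to equally many unit classes modulo n, so the count is
   phi(n) / phi(lcm(d, e)) = phi(n) phi((d, e)) / (phi(d) phi(e)). *)
Require Import Defs.
From mathcomp Require Import all_boot all_order all_algebra.
From mathcomp Require Import complex.
From mathcomp Require Import ring lra zify.
From mathcomp Require Import reals trigo.
Import Order.TTheory GRing.Theory Num.Theory.
Local Open Scope ring_scope.
Local Open Scope complex_scope.

(** * Divisor sums of the Möbius function *)

Lemma moebius_mul_prime (p m : nat) : prime p -> ~~ (p %| m)%N -> (0 < m)%N ->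
  moebius (p * m) = - moebius m.
Proof.
move=> p_pr pNm m_gt0; have p_gt0 := prime_gt0 p_pr.
have primes_pm : perm_eq (primes (p * m)) (p :: primes m).
  apply: uniq_perm => [||q]; first exact: primes_uniq.
    by rewrite /= primes_uniq mem_primes (negbTE pNm) !andbF.
  by rewrite primesM // primes_prime // !inE.
rewrite /moebius (perm_size primes_pm) (perm_has _ primes_pm) /=.
rewrite expnS expn1 dvdn_pmul2l // (negbTE pNm) /=.
(* A prime [q] dividing [m] differs from [p], so [q ^ 2] is coprime to [p] and divides [p * m]
   exactly when it divides [m]. *)
rewrite (eq_in_has (a2 := fun q => (q ^ 2 %| m)%N)) => [|q].
  by case: ifP; rewrite ?oppr0 // exprS mulN1r.
rewrite mem_primes => /and3P[q_pr _ qm] /=; rewrite Gauss_dvdr //.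
rewrite coprimeXl // prime_coprime // dvdn_prime2 //.
by apply: contraNneq pNm => <-.
Qed.

Lemma moebius_eq0 (p m : nat) : prime p -> (0 < m)%N -> (p ^ 2 %| m)%N ->
  moebius m = 0.
Proof.
move=> p_pr m_gt0 p2m; rewrite /moebius; case: hasP => // -[]; exists p => //.
by rewrite mem_primes p_pr m_gt0 (dvdn_trans _ p2m) // expnS dvdn_mulr.
Qed.

(* For a prime p | n, the involution swapping m and p m on the divisors of n
   not divisible by p^2 changes the sign of the Moebius function. *)
Lemma sum_moebius (n : nat) : (0 < n)%N ->
  \sum_(m <- divisors n) moebius m = (n == 1%N)%:R.
Proof.
move=> n_gt0; case: (ltngtP n 1%N) => [||->]; first by rewrite ltnNge n_gt0.
  move=> n_gt1; pose p := pdiv n; have p_pr : prime p by apply: pdiv_prime.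
  have p_gt0 := prime_gt0 p_pr; have pn : (p %| n)%N by apply: pdiv_dvd.
  pose h m := (if p %| m then m %/ p else p * m)%N.
  pose s := [seq m <- divisors n | ~~ (p ^ 2 %| m)%N].
  have hK : {in s, cancel h h}.
    move=> m; rewrite mem_filter => /andP[p2m _]; rewrite /h.
    case: (boolP (p %| m)%N) => pm; last by rewrite dvdn_mulr // mulKn.
    rewrite ifN; first by rewrite mulnC divnK.
    apply: contraNN p2m => /dvdnP[x xp].
    by rewrite -(divnK pm) xp -mulnA dvdn_mull.
  have hs : {in s, forall m, h m \in s}.
    move=> m; rewrite !mem_filter -!dvdn_divisors // /h => /andP[p2m mn].
    case: ifPn => pm.
      rewrite (dvdn_trans _ mn) ?dvdn_div // andbT.
      by apply: contraNN p2m => /dvdn_trans-> //; apply: dvdn_div.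
    rewrite expnS expn1 dvdn_pmul2l // pm Gauss_dvd ?pn //.
    by rewrite prime_coprime.
  have s_uniq : uniq s by rewrite filter_uniq // divisors_uniq.
  have hs_perm : perm_eq (map h s) s.
    apply: uniq_perm => // [|m].
      by rewrite map_inj_in_uniq //; apply: can_in_inj hK.
    apply/mapP/idP => [[x xs ->]|ms]; first exact: hs.
    by exists (h m); rewrite ?hK ?hs.
  rewrite (bigID (fun m => p ^ 2 %| m)%N) /= big1_seq ?add0r; last first.
    move=> m /andP[p2m]; rewrite -dvdn_divisors // => mn.
    by apply: moebius_eq0 p2m => //; apply: dvdn_gt0 mn.
  rewrite -big_filter -/s.
  (* Reindexing by [h] shows that the sum equals its own opposite, so it vanishes in the
     integers. *)
  have : \sum_(m <- s) moebius m = - \sum_(m <- s) moebius m.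
    rewrite -{1}(perm_big _ hs_perm) big_map -sumrN.
    apply: eq_big_seq => m; rewrite mem_filter -dvdn_divisors //.
    move=> /andP[p2m mn]; have m_gt0 := dvdn_gt0 n_gt0 mn; rewrite /h.
    case: ifPn => pm; last exact: moebius_mul_prime.
    rewrite -{2}(divnK pm) mulnC moebius_mul_prime ?opprK //.
      apply: contraNN p2m => /dvdnP[x xp].
      by rewrite -(divnK pm) xp -mulnA dvdn_mull.
    by rewrite divn_gt0 // dvdn_leq.
  by move: (\sum_(m <- s) _) => x; rewrite mulr0n; lia.
by rewrite big_cons big_nil.
Qed.

(** The divisors of [n] that divide [j] are the divisors of [gcdn j n], so [sum_moebius] applies to
    that gcd. *)
Lemma sum_moebius_coprime (n j : nat) : (0 < n)%N ->
  \sum_(m <- divisors n | (m %| j)%N) moebius m = (coprime j n)%:R.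
Proof.
move=> n_gt0; have g_gt0 : (0 < gcdn j n)%N by rewrite gcdn_gt0 n_gt0 orbT.
rewrite -big_filter -sum_moebius //; apply: perm_big.
apply: uniq_perm; rewrite ?filter_uniq ?divisors_uniq // => m.
by rewrite mem_filter -!dvdn_divisors // dvdn_gcd.
Qed.

(** * Roots of unity and the evaluation of Ramanujan sums *)

Lemma big_nat_dvd (V : nmodType) (m N : nat) (F : nat -> V) : (0 < m)%N ->
  \sum_(1 <= j < (m * N).+1 | (m %| j)%N) F j
  = \sum_(1 <= i < N.+1) F (m * i)%N.
Proof.
move=> m_gt0; rewrite -big_filter -(big_map (muln m) xpredT); apply: perm_big.
have mI : injective (muln m) by move=> x y /eqP; rewrite eqn_pmul2l // => /eqP.
apply: uniq_perm; rewrite ?map_inj_uniq ?filter_uniq ?iota_uniq // => j.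
rewrite mem_filter mem_index_iota; apply/andP/mapP.
  case=> /dvdnP[i ->] /andP[lo hi]; exists i; rewrite 1?mulnC //.
  rewrite mem_index_iota; move: lo hi; rewrite mulnC !ltnS leq_pmul2l // => lo ->.
  by case: i lo; rewrite ?muln0.
case=> i; rewrite mem_index_iota !ltnS => /andP[i_gt0 iN] ->.
by rewrite dvdn_mulr // muln_gt0 m_gt0 i_gt0 leq_mul2l iN orbT.
Qed.

Lemma expiD (R : realType) (x y : R) : expi (x + y) = expi x * expi y.
Proof.
by rewrite /expi cosD sinD; apply/eqP; rewrite eq_complex /= eqxx addrC eqxx.
Qed.

Lemma expi0 (R : realType) : expi (0 : R) = 1.
Proof. by rewrite /expi cos0 sin0. Qed.

Lemma expiMn (R : realType) (x : R) (m : nat) : expi (x *+ m) = expi x ^+ m.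
Proof. by elim: m => [|m IH]; rewrite ?mulr0n ?expi0 // mulrS expiD IH exprS. Qed.

Lemma expi_2piMz (R : realType) (k : int) : expi (2 * pi * k%:~R : R) = 1.
Proof.
have H (m : nat) : expi (2 * pi * m%:R : R) = 1.
  rewrite mulr_natr expiMn; suff -> : expi (2 * pi : R) = 1 by rewrite expr1n.
  by rewrite /expi mulr_natl cos2pi sin2pi.
case: k => m; first exact: H.
have := expi0 R; rewrite NegzE mulrNz -(subrr (2 * pi * m.+1%:R)) expiD H mul1r.
by rewrite mulrN.
Qed.

Lemma expi_eq1 (R : realType) (k : int) (N : nat) : (0 < N)%N ->
  (expi (2 * pi * k%:~R / N%:R : R) == 1) = (N%:Z %| k)%Z.
Proof.
move=> N_gt0; have N_neq0 : N%:R != 0 :> R by rewrite pnatr_eq0 -lt0n.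
apply/idP/idP; last first.
  case/dvdzP => q ->; rewrite intrM mulrA -[N%:~R]/(N%:R) mulfK //.
  by rewrite expi_2piMz.
move=> /eqP; have NZ : N%:Z != 0 by rewrite -lt0n.
rewrite {1}(divz_eq k N) intrD intrM mulrDr mulrDl expiD.
rewrite mulrA -[N%:~R]/(N%:R) mulfK // expi_2piMz mul1r.
have := modz_ge0 k NZ; have := ltz_pmod k (_ : 0 < N%:Z) => /(_ N_gt0).
case E: (k %% N)%Z => [x|//]; rewrite ltz_nat => x_lt _.
case: x E x_lt => [|x] E x_lt; first by move=> _; apply/dvdz_mod0P.
(* The nonzero remainder [x.+1] is below [N], so the half angle [t] lies strictly between 0 and pi.
   Hence [sin t > 0], and [cos (2 t) = 1 - 2 sin^2 t] is less than 1. *)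
set t : R := pi * x.+1%:R / N%:R.
have t_bounds : 0 < t < pi.
  rewrite /t -mulrA mulr_gt0 ?pi_gt0 ?divr_gt0 ?ltr0n //=.
  by rewrite gtr_pMr ?pi_gt0 // ltr_pdivrMr ?ltr0n // mul1r ltr_nat.
have -> : 2 * pi * x.+1%:~R / N%:R = t *+ 2 by rewrite /t -pmulrn; ring.
have := sin_gt0_pi t_bounds; rewrite /expi cos_mulr2n => sin_gt0 [].
have := cos2Dsin2 t; nra.
Qed.

(** Multiplying the geometric sum from exponent 0 by [w - 1] gives [w ^+ N - 1 = 0]; starting at
    exponent 1 only brings out a factor [w]. *)
Lemma sum_root1 (F : fieldType) (w : F) (N : nat) : w ^+ N = 1 ->
  \sum_(1 <= i < N.+1) w ^+ i = if w == 1 then N%:R else 0.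
Proof.
move=> wN; case: eqP => [->|/eqP w_neq1].
  under eq_bigr do rewrite expr1n.
  by rewrite sumr_const_nat subn1.
under eq_bigr do rewrite -[_ ^+ _]mul1r.
rewrite big_add1 /= big_mkord; under eq_bigr do rewrite mul1r exprS.
rewrite -mulr_sumr; have := subrX1 w N; rewrite wN subrr => /esym/eqP.
by rewrite mulf_eq0 subr_eq0 (negbTE w_neq1) => /eqP->; rewrite mulr0.
Qed.

Lemma ramanujan_sumE (R : realType) (n : nat) (k : int) : (0 < n)%N ->
  ramanujan_sum R n k
  = \sum_(e <- divisors n | (e%:Z %| k)%Z) e%:R * (moebius (n %/ e))%:~R.
Proof.
move=> n_gt0; pose z := expi (2 * pi * k%:~R / n%:R : R).
have zE j : expi (2 * pi * j%:R * k%:~R / n%:R : R) = z ^+ j.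
  by rewrite -expiMn -mulr_natl; congr expi; ring.
have coprimeE j : (coprime j n)%:R
    = \sum_(m <- divisors n) (if (m %| j)%N then (moebius m)%:~R else 0) :> R[i].
  rewrite -big_mkcond -[RHS]rmorph_sum sum_moebius_coprime //.
  by rewrite rmorph_nat.
rewrite /ramanujan_sum.
under eq_bigr do rewrite zE.
rewrite big_mkcond /=.
under eq_bigr => j _.
  rewrite -mulrb -mulr_natl coprimeE mulr_suml.
  over.
rewrite exchange_big /=.
(* [G m] is the inner sum for [m]: with [j = m * i] it runs over the powers of [z ^+ m], a root of
   unity of order dividing [n %/ m], which equals 1 exactly when [n %/ m] divides [k]. *)
pose G m : R[i] :=
  (if ((n %/ m)%N%:Z %| k)%Z then (n %/ m)%:R else 0) * (moebius m)%:~R.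
transitivity (\sum_(m <- divisors n) G m).
  apply: eq_big_seq => m; rewrite -dvdn_divisors // => mn.
  have m_gt0 := dvdn_gt0 n_gt0 mn.
  have N_gt0 : (0 < n %/ m)%N by rewrite divn_gt0 // dvdn_leq.
  transitivity (\sum_(1 <= j < n.+1 | (m %| j)%N) (moebius m)%:~R * z ^+ j).
    rewrite [RHS]big_mkcond; apply: eq_bigr => j _.
    by case: ifP => // _; rewrite mul0r.
  rewrite -mulr_sumr mulrC -{1}(divnK mn) mulnC big_nat_dvd //.
  under eq_bigr do rewrite exprM.
  have zmE : z ^+ m = expi (2 * pi * k%:~R / (n %/ m)%:R : R).
    rewrite -zE -{1}(divnK mn) natrM; congr expi.
    by field; rewrite !pnatr_eq0 -!lt0n N_gt0 m_gt0.
  rewrite sum_root1 ?zmE ?expi_eq1 // -zmE.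
  rewrite -exprM mulnC divnK // -zE -(expi_2piMz R k); congr expi.
  by field; rewrite pnatr_eq0 -lt0n.
(* The complementary divisor [e = n %/ m] turns the sum of the [G m] into the stated one. *)
have divnnK : {in divisors n, cancel (divn n) (divn n)}.
  move=> m; rewrite -dvdn_divisors // => mn.
  by rewrite -{1}(divnK mn) mulKn // divn_gt0 ?(dvdn_gt0 n_gt0 mn) // dvdn_leq.
have divn_divisors : {in divisors n, forall m, (n %/ m)%N \in divisors n}.
  by move=> m; rewrite -!dvdn_divisors //; apply: dvdn_div.
have perm : perm_eq (map (divn n) (divisors n)) (divisors n).
  apply: uniq_perm; rewrite ?divisors_uniq //.
    by rewrite map_inj_in_uniq ?divisors_uniq //; apply: can_in_inj divnnK.
  move=> m; apply/mapP/idP => [[x xn ->]|mn]; first exact: divn_divisors.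
  by exists (n %/ m)%N; rewrite ?divnnK ?divn_divisors.
rewrite -(perm_big _ perm) big_map [RHS]big_mkcond; apply: eq_big_seq => m mn.
by rewrite /G divnnK //; case: ifP; rewrite ?mul0r.
Qed.

(** * Totients and the number of units in a residue class *)

Lemma totient_lcm_gcd (a b : nat) : (0 < a)%N -> (0 < b)%N ->
  (totient (lcmn a b) * totient (gcdn a b) = totient a * totient b)%N.
Proof.
move=> a_gt0 b_gt0.
(* For prime [p], [h p e] is the totient of [p ^ e]. Its value 1 at [e = 0] lets all four products
   run over the primes up to [a * b]. At each prime, the lcm and the gcd have the larger and the
   smaller of the two exponents, so the same two factors occur on both sides. *)
pose h p e := (if e == 0 then 1 else p.-1 * p ^ e.-1)%N.
have totientE m : (0 < m)%N -> (m <= a * b)%N ->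
    totient m = (\prod_(p < (a * b).+1 | prime p) h p (logn p m))%N.
  move=> m_gt0 m_le; rewrite totientE //.
  rewrite -(big_mkord (fun p => prime p) (fun p => h p (logn p m))).
  rewrite [RHS](bigID (fun p => p \in primes m)) /=.
  rewrite [X in (_ * X)%N]big1 ?muln1; last first.
    move=> p /andP[p_pr]; rewrite -logn_gt0 lt0n negbK => /eqP-> //.
  rewrite -[RHS]big_filter; rewrite big_seq.
  under eq_bigr.
    move=> p; rewrite -logn_gt0 => /prednK E.
    have -> : (p.-1 * p ^ (logn p m).-1)%N = h p (logn p m) by rewrite -E.
    over.
  rewrite -big_seq.
  apply: perm_big; apply: uniq_perm.
  - exact: primes_uniq.
  - by rewrite filter_uniq ?iota_uniq.
  move=> p; rewrite mem_filter mem_index_iota /= mem_primes.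
  case: (boolP (prime p)) => //= _; rewrite m_gt0 /=.
  case: (boolP (p %| m)%N) => //= pm.
  by rewrite ltnS (leq_trans _ m_le) // dvdn_leq.
have ab_gt0 : (0 < a * b)%N by rewrite muln_gt0 a_gt0.
have le_lcm : (lcmn a b <= a * b)%N.
  by rewrite dvdn_leq // dvdn_lcm dvdn_mulr // dvdn_mull.
have le_gcd : (gcdn a b <= a * b)%N.
  by rewrite dvdn_leq // dvdn_mulr // dvdn_gcdl.
rewrite !totientE ?lcmn_gt0 ?gcdn_gt0 ?a_gt0 ?b_gt0 ?leq_pmulr ?leq_pmull //.
rewrite -!big_split /=; apply: eq_bigr => p _; rewrite logn_lcm // logn_gcd //.
case: (leqP (logn p a) (logn p b)) => // _; by rewrite mulnC.
Qed.

(* The witness adds to t a multiple of m whose cofactor is divisible, among the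
   primes of n, by exactly those not dividing t. *)
Lemma exists_coprime_eqmod (n m t : nat) : (0 < n)%N -> (0 < t)%N ->
  coprime t m -> exists2 u, coprime u n & (u == t %[mod m])%N.
Proof.
move=> n_gt0 t_gt0 co_tm; exists (t + n`_\pi(t)^' * m)%N; last first.
  by rewrite addnC modnMDl.
have x_gt0 : (0 < n`_\pi(t)^')%N by apply: part_gt0.
have [m0|m_gt0] := posnP m.
  by move: co_tm; rewrite m0 /coprime gcdn0 muln0 addn0 => /eqP->; rewrite gcd1n.
rewrite coprime_has_primes ?addn_gt0 ?t_gt0 //; apply/hasPn => p.
rewrite mem_primes => /and3P[p_pr _ pn]; rewrite /= mem_primes p_pr addn_gt0 t_gt0 /=.
case: (boolP (p %| t)%N) => pt.
  rewrite dvdn_addr // Euclid_dvdM // negb_or; apply/andP; split.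
    apply/negP => px; have /pnatP := part_pnat \pi(t)^' n.
    move=> /(_ x_gt0 p p_pr px); rewrite !inE /= mem_primes p_pr t_gt0 pt //.
  apply/negP => pm; have := dvdn_gcd p t m; rewrite pt pm (eqP co_tm) dvdn1.
  by move/eqP=> p1; rewrite p1 in p_pr.
rewrite dvdn_addl // dvdn_mulr //.
have : (p %| n`_\pi(t)^' * n`_\pi(t))%N by rewrite mulnC partnC.
rewrite Euclid_dvdM // => /orP[//|px].
have /pnatP := part_pnat \pi(t) n; rewrite part_gt0 => /(_ isT p p_pr px).
by rewrite mem_primes (negbTE pt) !andbF.
Qed.

(** Passes to the residues 0 to n - 1, where a sum can be reindexed by a permutation of ['I_n]. *)
Lemma big_nat_periodic (V : nmodType) (n : nat) (F : nat -> V) : (0 < n)%N ->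
  F n = F 0%N -> \sum_(1 <= k < n.+1) F k = \sum_(k < n) F k.
Proof.
case: n => // n _ F0; rewrite big_nat_recr //= F0 -(big_mkord xpredT) addrC.
by rewrite [RHS]big_ltn.
Qed.

(** The units modulo [n] are spread evenly over the [totient m] unit classes modulo [m]. *)
Lemma sum_coprime_eqmod (n m t : nat) : (0 < n)%N -> (m %| n)%N ->
  coprime t m ->
  ((\sum_(1 <= k < n.+1) (coprime k n && (k == t %[mod m])))
     * totient m = totient n)%N.
Proof.
move=> n_gt0 mn co_tm; have m_gt0 := dvdn_gt0 n_gt0 mn.
rewrite (@big_nat_periodic nat) //; last first.
  by rewrite /coprime gcdnn gcd0n -(divnK mn) modnMl mod0n.
pose f t := (\sum_(k < n) (coprime k n && (k == t %[mod m])))%N.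
have fE u : coprime u m -> f u = f 1%N.
  move=> co_um.
  (* [u] may be 0 when [m = 1]; adding [m] supplies the positive representative that
     [exists_coprime_eqmod] asks for. *)
  have [v co_vn vu] : exists2 v, coprime v n & (v == u + m %[mod m])%N.
    apply: exists_coprime_eqmod; rewrite ?addn_gt0 ?m_gt0 ?orbT //.
    by rewrite coprime_sym /coprime gcdnDr gcdnC.
  (* Multiplication by v permutes the units modulo n and carries the class of 1
     modulo m to that of u. *)
  pose h (k : 'I_n) := Ordinal (ltn_pmod (v * k) n_gt0).
  have h_inj : injective h.
    move=> i j /(congr1 val)/eqP /=.
    wlog le_ij : i j / (i <= j)%N.
      by move=> H; case/orP: (leq_total i j) => le /eqP E; [|symmetry]; apply: H; rewrite ?E.
    rewrite eq_sym eqn_mod_dvd ?leq_mul2l ?le_ij ?orbT // -mulnBr.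
    rewrite Gauss_dvdr 1?coprime_sym // => nij; apply/val_inj/eqP; rewrite /= eqn_leq le_ij.
    rewrite -subn_eq0; apply: contraTT nij => ij_neq0.
    rewrite gtnNdvd ?lt0n // (leq_ltn_trans (leq_subr _ _)) //.
  rewrite /f (reindex_inj h_inj); apply: eq_bigr => k _ /=.
  rewrite coprime_modl coprimeMl co_vn /= modn_dvdm //.
  congr (nat_of_bool (_ && _)).
  move: vu; rewrite modnDr => /eqP vu; rewrite -modnMml vu modnMml.
  rewrite -[X in _ == X %[mod _]]muln1.
  (* Here [u] is cancelled modulo [m]. The case [k = 0] is apart because subtraction on [nat] is
     truncated. *)
  have [le|/ltnW le] := leqP 1 k.
    by rewrite !eqn_mod_dvd ?leq_mul2l ?le ?orbT // -mulnBr Gauss_dvdr // coprime_sym.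
  rewrite eq_sym [RHS]eq_sym.
  by rewrite !eqn_mod_dvd ?leq_mul2l ?le ?orbT // -mulnBr Gauss_dvdr // coprime_sym.
rewrite -/(f t) fE // mulnC !totient_count_coprime !big_mkord big_distrl /=.
(* Double counting of the pairs of a unit class [u] modulo [m] and a unit [k] modulo [n] in it: each
   [k] lies in exactly one such class, since [m] divides [n]. *)
transitivity (\sum_(u < m) \sum_(k < n)
    (coprime u m && (coprime k n && (k == u %[mod m]))))%N.
  apply: eq_bigr => u _; rewrite coprime_sym; case: (boolP (coprime u m)) => co_um.
    by rewrite mul1n -(fE u).
  by rewrite mul0n big1.
rewrite exchange_big /=; apply: eq_bigr => k _; rewrite [in RHS]coprime_sym.
have [co_kn|] := boolP (coprime k n); last first.
  by move=> _; rewrite big1 // => u _; rewrite andbF.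
rewrite (bigD1 (Ordinal (ltn_pmod k m_gt0))) //= modn_mod eqxx coprime_modl.
rewrite (coprime_dvdr mn co_kn) big1 // => u; rewrite -val_eqE /= eq_sym => uk.
by rewrite [X in _ == X]modn_small // (negbTE uk) andbF.
Qed.

(** * Counting the units that satisfy two congruences *)

Lemma chinese_gcdz (d e r s : int) : (gcdz d e %| r - s)%Z ->
  exists2 t, (d %| t - r)%Z & (e %| t - s)%Z.
Proof.
case/dvdzP => q rs; have [u [v uv]] := Bezoutz d e.
(* Since [r - s = q * (u * d + v * e)], this number is also [s + q * v * e]. *)
exists (r - q * u * d); first by apply/dvdzP; exists (- (q * u)); ring.
by apply/dvdzP; exists (q * v); rewrite addrAC rs -uv; ring.
Qed.

Lemma gcdz_eqmod (a b d : int) : (d %| a - b)%Z -> gcdz a d = gcdz b d.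
Proof. by rewrite -eqz_mod_dvd -gcdz_modl => /eqP->; rewrite gcdz_modl. Qed.

(** The totients of [d] and [e] multiply the count so that the identity holds in [nat] without
    division. *)
Lemma sum_coprime_eqmod2 (n d e : nat) (r s : int) : (0 < n)%N ->
  (d %| n)%N -> (e %| n)%N ->
  ((\sum_(1 <= k < n.+1)
      [&& coprime k n, (k%:Z == r %[mod d%:Z])%Z & (e%:Z %| (k%:Z - s)%R)%Z])
     * (totient d * totient e)
   = if [&& gcdz r d%:Z == 1, gcdz e%:Z s == 1 & ((gcdn e d)%:Z %| (r - s)%R)%Z]
     then totient n * totient (gcdn e d) else 0)%N.
Proof.
move=> n_gt0 dn en; have d_gt0 := dvdn_gt0 n_gt0 dn; have e_gt0 := dvdn_gt0 n_gt0 en.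
have L_gt0 : (0 < lcmn d e)%N by rewrite lcmn_gt0 d_gt0.
case: ifPn => [/and3P[/eqP rd /eqP es rs]|noncomp]; last first.
  (* Any counted [k] would force all three conditions: it is coprime to [d] and [e], being coprime
     to [n], and [r - s] is the difference of [k - s] and [k - r]. *)
  rewrite big_nat big1 // => k _; apply/eqP; rewrite eqb0.
  apply: contra noncomp => /and3P[co_kn]; rewrite eqz_mod_dvd => kr ks.
  rewrite -(gcdz_eqmod _ _ _ kr) gcdzC [gcdz e%:Z s]gcdzC -(gcdz_eqmod _ _ _ ks).
  rewrite /gcdz !absz_nat gcdnC -/(coprime k d).
  rewrite -[_ == 1]/(coprime k d) -[_ == 1]/(coprime k e).
  rewrite !(coprime_dvdr _ co_kn) //=.
  have -> : r - s = (k%:Z - s) - (k%:Z - r) by ring.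
  apply: rpredB; [apply: dvdz_trans ks|apply: dvdz_trans kr].
    by rewrite dvdzE dvdn_gcdl.
  by rewrite dvdzE dvdn_gcdr.
have [|t td te] := chinese_gcdz d%:Z e%:Z r s; first by rewrite gcdzC.
(* [t0] is the natural representative modulo the lcm of a common solution [t] of the two
   congruences. *)
have [t0 t0E] : exists t0 : nat, (t %% (lcmn d e)%:Z)%Z = t0.
  by exists `|(t %% (lcmn d e)%:Z)%Z|%N; rewrite gez0_abs // modz_ge0 // -lt0n.
have co_t : coprime t0 (lcmn d e).
  have : gcdz t (lcmn d e) = 1.
    have /eqP co_td : coprimez t d by rewrite /coprimez (gcdz_eqmod _ _ _ td) rd.
    have /eqP co_te : coprimez t e.
      by rewrite /coprimez (gcdz_eqmod _ _ _ te) gcdzC es.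
    apply/eqP; rewrite -[_ == 1]/(coprime `|t| (lcmn d e)).
    apply: (@coprime_dvdr _ (d * e)); first by rewrite dvdn_lcm dvdn_mulr // dvdn_mull.
    by rewrite coprimeMr; apply/andP; split; apply/eqP; [case: co_td|case: co_te].
  by rewrite -gcdz_modl t0E => -[] /eqP.
have condE (k : nat) : (k%:Z == r %[mod d%:Z])%Z && (e%:Z %| k%:Z - s)%Z
    = (k == t0 %[mod lcmn d e])%N.
  rewrite eqz_mod_dvd.
  have -> : k%:Z - r = (k%:Z - t) + (t - r) by ring.
  have -> : k%:Z - s = (k%:Z - t) + (t - s) by ring.
  rewrite (rpredDr _ td) (rpredDr _ te).
  rewrite -[LHS]/((d %| `|k%:Z - t|)%N && (e %| `|k%:Z - t|)%N) -dvdn_lcm.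
  rewrite -[LHS]/((lcmn d e)%:Z %| k%:Z - t)%Z.
  by rewrite -eqz_mod_dvd -[in RHS]eqz_nat -!modz_nat -t0E modz_mod.
under eq_bigr do rewrite condE.
rewrite -totient_lcm_gcd // mulnA sum_coprime_eqmod // 1?gcdnC //.
by rewrite dvdn_lcm dn.
Qed.

Theorem corollary2p3 (R : realType) (n d : nat) (hn : (0 < n)%N)
    (hd : (0 < d)%N) (hdn : (d %| n)%N) (r s : int) :
  \sum_(1 <= k < n.+1 | coprime k n && (k%:Z == r %[mod d%:Z])%Z)
     ramanujan_sum R n (k%:Z - s)
  = (if gcdz r d%:Z == 1 then
       (totient n)%:R / (totient d)%:R *
       \sum_(e <- divisors n | (gcdz e%:Z s == 1)
                               && ((gcdn e d)%:Z %| r - s)%Z)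
          e%:R * (moebius (n %/ e))%:~R / (totient e)%:R
          * (totient (gcdn e d))%:R
     else 0 :> R[i]).
Proof.
have totient_neq0 m : (m %| n)%N -> (totient m)%:R != 0 :> R[i].
  by move=> mn; rewrite pnatr_eq0 -lt0n totient_gt0 (dvdn_gt0 hn mn).
(* [N e] collects, after the exchange of sums, the [k] for which [e] enters the evaluation of the
   Ramanujan sum at [k - s]. *)
pose N e := (\sum_(1 <= k < n.+1)
  [&& coprime k n, (k%:Z == r %[mod d%:Z])%Z & (e%:Z %| (k%:Z - s)%R)%Z])%N.
transitivity (\sum_(e <- divisors n)
    e%:R * (moebius (n %/ e))%:~R * (N e)%:R : R[i]).
  under eq_bigr do rewrite ramanujan_sumE // big_mkcond.
  rewrite exchange_big /=; apply: eq_bigr => e _.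
  rewrite /N natr_sum mulr_sumr big_mkcond; apply: eq_bigr => k _.
  rewrite andbA; case: (_ && _) => /=; last by rewrite mulr0.
  by case: ifP; rewrite ?mulr1 ?mulr0.
have NE e : (e %| n)%N -> (N e)%:R
    = if [&& gcdz r d%:Z == 1, gcdz e%:Z s == 1 & ((gcdn e d)%:Z %| r - s)%Z]
      then (totient n)%:R * (totient (gcdn e d))%:R
             / ((totient d)%:R * (totient e)%:R) else 0 :> R[i].
  move=> en; have de_neq0 := mulf_neq0 (totient_neq0 _ hdn) (totient_neq0 _ en).
  apply: (mulIf de_neq0); rewrite -!natrM sum_coprime_eqmod2 //.
  by case: ifP; rewrite ?mul0r // natrM mulfVK // natrM.
(* If [r] is not coprime to [d], every [N e] is zero. *)
case: ifP NE => [_|_] /= NE; last first.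
  by rewrite big1_seq // => e; rewrite -dvdn_divisors // => en; rewrite NE // mulr0.
rewrite mulr_sumr [RHS]big_mkcond; apply: eq_big_seq => e.
rewrite -dvdn_divisors // => en; rewrite NE //.
case: ifP => _; last by rewrite mulr0.
by field; rewrite !totient_neq0.
Qed.
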